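(* Assume $\mathfrak{p}=\mathfrak{c}$. Let $\mathcal{P}$ be a collection of at most $\mathfrak{c}$ many proper posets, each of size $\mathfrak{c}$. Then there is a maximal tower $X$ which is indestructible by every $\mathbb{P}\in\mathcal{P}$, i.e. for every $\mathbb{P}\in\mathcal{P}$, $\mathbb{P}$ forces that $X$ has no pseudointersection.
   Context: For $x,y\in[\omega]^\omega$, $y\subseteq^* x$ means $y\setminus x$ is finite. A pseudointersection of a family $\mathcal F\subseteq[\omega]^\omega$ is an infinite $z\subseteq\omega$ with $z\subseteq^* x$ for all $x\in\mathcal F$. A tower is a set $X\subseteq[\omega]^\omega$ well ordered by $x\le y$ iff $y\subseteq^* x$; it is maximal if it has no pseudointersection. $\mathfrak{p}$ is the least cardinal $\kappa$ such that some $\mathcal F\subseteq[\omega]^\omega$ of size $\kappa$ with the finite intersection property (every finite subfamily has infinite intersection) has no pseudointersection. $\mathfrak{c}=2^{\aleph_0}$. *)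

(* Defs.v *)
From mathcomp Require Import all_boot all_order all_classical.
From mathcomp Require wochoice.

Set Implicit Arguments.
Unset Strict Implicit.
Unset Printing Implicit Defensive.

Local Open Scope classical_set_scope.
Local Open Scope card_scope.

Definition almost_sub (y x : set nat) : Prop := finite_set (y `\` x).

Definition pseudointersection (F : set (set nat)) (z : set nat) : Prop :=
  infinite_set z /\ forall x, F x -> almost_sub z x.

Definition has_pseudointersection (F : set (set nat)) : Prop :=
  exists z, pseudointersection F z.

(* [wo_chain]: every nonempty subset has a unique minimum, which amounts to
   being well ordered. *)
Definition tower (X : set (set nat)) : Prop :=
  (forall x, X x -> infinite_set x) /\
  wochoice.wo_chain (fun x y => `[< almost_sub y x >]) (mem X).

Definition maximal_tower (X : set (set nat)) : Prop :=
  tower X /\ ~ has_pseudointersection X.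

Definition fip (F : set (set nat)) : Prop :=
  forall G, G `<=` F -> finite_set G -> infinite_set (\bigcap_(x in G) x).

Definition p_witness (F : set (set nat)) : Prop :=
  [/\ forall x, F x -> infinite_set x, fip F & ~ has_pseudointersection F].

(* There is no type of cardinals: a cardinal is represented by any set [K]
   having that cardinality, and this says that the cardinality of [K] is p. *)
Definition has_cardinality_p T (K : set T) : Prop :=
  (exists2 F, p_witness F & F #= K) /\ (forall F, p_witness F -> K #<= F).

Definition continuum : set (set nat) := setT.

Section Stationary.
Context {A : Type}.

(* These live in [A]^{<= aleph_0}, the countable (possibly finite) subsets. *)
Definition club (C : set (set A)) : Prop :=
  [/\ forall s, C s -> countable s,
      forall s, countable s -> exists2 t, C t & s `<=` t
    & forall u : nat -> set A,
        (forall n, C (u n)) -> (forall n, u n `<=` u n.+1) ->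
        C (\bigcup_n u n)].

Definition stationary (S : set (set A)) : Prop :=
  (forall s, S s -> countable s) /\
  (forall C, club C -> exists2 s, C s & S s).

End Stationary.

(* Forcing. Conditions form a poset in which [q <= p] means that [q] is
   stronger than [p].  A sentence of the forcing language is identified with
   the predicate "[p] forces it"; the clauses below are the usual recursive
   ones.  Every sentence built from them is regular (it is forced by [p] as soon
   as the conditions forcing it are dense below [p]), so the clause for [fimp]
   agrees with that for ~ (phi /\ ~ psi). *)

Definition sentence d (P : porderType d) : Type := P -> Prop.

Section Connectives.
Context {d : Order.disp_t} {P : porderType d}.
Implicit Types (p q r : P) (phi psi : sentence P).

Definition dense_below (D : set P) p : Prop :=
  forall q, (q <= p)%O -> exists2 r, (r <= q)%O & D r.

(* A sentence that is about the ground model only, e.g. a = b for check names *)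
Definition fground (Q : Prop) : sentence P := fun=> Q.

Definition fnot phi : sentence P :=
  fun p => forall q, (q <= p)%O -> ~ phi q.

Definition fand phi psi : sentence P := fun p => phi p /\ psi p.

Definition fimp phi psi : sentence P :=
  fun p => forall q, (q <= p)%O -> phi q -> psi q.

(* When [X] is a type of names, these quantify over the corresponding objects
   of the extension; when [X] is a ground model type, over the elements of its
   check name. *)
Definition fall X (phi : X -> sentence P) : sentence P :=
  fun p => forall x, phi x p.

Definition fex X (phi : X -> sentence P) : sentence P :=
  dense_below [set q | exists x, phi x q].

Definition forced phi : Prop := forall p, phi p.

End Connectives.

(* A P-name for a subset of (the check name of) a ground model type [A] is a set
   of pairs (condition, check name of an element of A); every subset of A in the
   extension has such a name.  A P-name for a set of subsets of A is likewise a
   set of pairs (condition, name for a subset of A), i.e. an element of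
   [name P (name P A)]. *)
Definition name d (P : porderType d) (A : Type) : Type := set (P * A).

Section Forcing.
Context {d : Order.disp_t} {P : porderType d}.

Definition fmem A (a : A) (s : name P A) : sentence P :=
  dense_below [set q | exists2 r, s (r, a) & (q <= r)%O].

Definition fsub A (s t : name P A) : sentence P :=
  fall (fun a : A => fimp (fmem a s) (fmem a t)).

Definition feq A (s t : name P A) : sentence P := fand (fsub s t) (fsub t s).

Definition fmem2 A (s : name P A) (C : name P (name P A)) : sentence P :=
  dense_below
    [set q | exists r t, [/\ C (r, t), (q <= r)%O & feq s t q]].

Definition check A (s : set A) : name P A := [set x | s x.2].

Definition check2 A (S : set (set A)) : name P (name P A) :=
  [set x | exists2 s, S s & x.2 = check s].

(* Set difference of a subset of the extension and a ground model set *)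
Definition fsetD A (s : name P A) (x : set A) : name P A :=
  [set y | s y /\ ~ x y.2].

Definition finjection A B (s : name P A) (t : name P B) (f : name P (A * B)) :
    sentence P :=
  fand (fall (fun a => fall (fun b =>
          fimp (fmem (a, b) f) (fand (fmem a s) (fmem b t)))))
  (fand (fall (fun a => fimp (fmem a s) (fex (fun b => fmem (a, b) f))))
  (fand (fall (fun a => fall (fun b => fall (fun b' =>
          fimp (fand (fmem (a, b) f) (fmem (a, b') f)) (fground (b = b'))))))
        (fall (fun a => fall (fun a' => fall (fun b =>
          fimp (fand (fmem (a, b) f) (fmem (a', b) f)) (fground (a = a')))))))).

Definition fcard_le A B (s : name P A) (t : name P B) : sentence P :=
  fex (finjection s t).

Definition fcountable A (s : name P A) : sentence P :=
  fcard_le s (check [set: nat]).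

Definition ffinite A (s : name P A) : sentence P :=
  fex (fun n : nat => fcard_le s (check `I_n)).

(* A sequence [u] of names amounts to a name for a subset of nat * A, i.e. to
   a name for an omega-sequence of subsets of A. *)
Definition fbigcup A (u : nat -> name P A) : name P A := \bigcup_n u n.

Definition fclub A (C : name P (name P A)) : sentence P :=
  fand (fall (fun s => fimp (fmem2 s C) (fcountable s)))
  (fand (fall (fun s => fimp (fcountable s)
          (fex (fun t => fand (fmem2 t C) (fsub s t)))))
        (fall (fun u : nat -> name P A =>
          fimp (fand (fall (fun n => fmem2 (u n) C))
                     (fall (fun n => fsub (u n) (u n.+1))))
               (fmem2 (fbigcup u) C)))).

Definition fstationary A (S : name P (name P A)) : sentence P :=
  fand (fall (fun s => fimp (fmem2 s S) (fcountable s)))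
       (fall (fun C => fimp (fclub C)
          (fex (fun s => fand (fmem2 s C) (fmem2 s S))))).

Definition fpseudointersection (X : set (set nat)) (z : name P nat) :
    sentence P :=
  fand (fnot (ffinite z))
       (fall (fun x : set nat => fimp (fground (X x)) (ffinite (fsetD z x)))).

Definition fhas_pseudointersection (X : set (set nat)) : sentence P :=
  fex (fpseudointersection X).

End Forcing.

(* Shelah's original definition: forcing with P preserves the stationary subsets
   of [A]^{<= aleph_0}, for every uncountable A. *)
Definition proper_poset d (P : porderType d) : Prop :=
  forall A : Type, ~ countable [set: A] ->
  forall S : set (set A), stationary S ->
  forced (fstationary (check2 S : name P (name P A))).

Definition indestructible d (P : porderType d) (X : set (set nat)) : Prop :=
  forced (fnot (fhas_pseudointersection X) : sentence P).

(* Main.v *)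
(* Properness is used only in the form: below any condition, countably many
   antichains have countable subsets that the generic filter cannot avoid if it
   meets the antichains.  Hence every name for a real is equal, below some
   condition, to a name mentioning countably many conditions, and there are
   only c many pairs (q, y) of a condition and such a name for an infinite set.

   The tower is built by recursion of length c = p.  At a stage handling (q, y),
   split a pseudointersection of the tower so far into infinite disjoint sets z0
   and z1; [q] cannot force both that y is almost contained in z0 and that it is
   almost contained in z1, since y would be finite.  So one of the two halves can
   be added to prevent [q] from forcing that y is a pseudointersection. *)
Require Import Defs.
From mathcomp Require Import all_boot all_order all_classical.
From mathcomp Require wochoice.

Local Open Scope classical_set_scope.
Local Open Scope card_scope.

Set Implicit Arguments.
Unset Strict Implicit.
Unset Printing Implicit Defensive.

Import Order.POrderTheory.

(** * Forcing *)

Section ForcingFacts.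
Context {d : Order.disp_t} {P : porderType d}.
Implicit Types (p q r : P).

Lemma dense_belowW (D : set P) p q :
  (q <= p)%O -> dense_below D p -> dense_below D q.
Proof. by move=> qp Dp r /le_trans /(_ qp) /Dp. Qed.

Lemma dense_below_dense (D : set P) p :
  dense_below [set q | dense_below D q] p -> dense_below D p.
Proof.
move=> Dp q /Dp[r rq /(_ r (lexx r))[s sr Ds]].
by exists s => //; exact: le_trans rq.
Qed.

Lemma sub_dense_below (D E : set P) p :
  (forall q, (q <= p)%O -> D q -> E q) -> dense_below D p -> dense_below E p.
Proof.
move=> DE Dp q qp; have [r rq Dr] := Dp q qp.
by exists r => //; apply: DE => //; exact: le_trans qp.
Qed.

Lemma fmemW A (a : A) (s : name P A) p q :
  (q <= p)%O -> fmem a s p -> fmem a s q.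
Proof. exact: dense_belowW. Qed.

Lemma fmem_dense A (a : A) (s : name P A) p :
  dense_below (fmem a s) p -> fmem a s p.
Proof. exact: dense_below_dense. Qed.

Lemma fmem_base A (a : A) (s : name P A) p r :
  s (r, a) -> (p <= r)%O -> fmem a s p.
Proof.
by move=> sa pr q qp; exists q => //; exists r => //; exact: le_trans pr.
Qed.

Lemma fmem_check A (a : A) (s : set A) p : fmem a (check s) p <-> s a.
Proof.
split=> [/(_ p (lexx p))[q _ [r]] //|sa].
exact: (fmem_base (r := p)).
Qed.

Lemma fmem_setD A (a : A) (s : name P A) (x : set A) p :
  fmem a (fsetD s x) p <-> fmem a s p /\ ~ x a.
Proof.
split=> [h|[h nx] q /h[r rq [t st rt]]]; last by exists r => //; exists t.
split; last by have [q _ [r [_ nx] _]] := h p (lexx p).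
by apply: sub_dense_below h => q _ [r [sr _] qr]; exists r.
Qed.

Lemma fmem_bigcup A (a : A) (u : nat -> name P A) p :
  fmem a (fbigcup u) p <-> dense_below [set q | exists n, fmem a (u n) q] p.
Proof.
split.
  apply: sub_dense_below => q _ [r [n _ unr] qr]; exists n.
  exact: fmem_base unr qr.
move=> h; apply: dense_below_dense; apply: sub_dense_below h => q _ [n].
by apply: sub_dense_below => r _ [t st rt]; exists t => //; exists n.
Qed.

Lemma fsubW A (s t : name P A) p q : (q <= p)%O -> fsub s t p -> fsub s t q.
Proof. by move=> qp st a r rq; apply: st; exact: le_trans qp. Qed.

Lemma fsub_refl A (s : name P A) p : fsub s s p.
Proof. by move=> a q _. Qed.

Lemma fsub_trans A (s t u : name P A) p :
  fsub s t p -> fsub t u p -> fsub s u p.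
Proof. by move=> st tu a q qp aq; apply: (tu a q qp); exact: st. Qed.

Lemma fsub_dense A (s t : name P A) p : dense_below (fsub s t) p -> fsub s t p.
Proof.
move=> h a q qp aq; apply: fmem_dense => r rq.
have [v vr stv] := h r (le_trans rq qp); exists v => //; apply: stv => //.
by apply: fmemW aq; exact: le_trans rq.
Qed.

Lemma fsub_setD A (s t : name P A) (x : set A) p :
  fsub s t p -> fsub (fsetD s x) (fsetD t x) p.
Proof.
by move=> st a q qp /fmem_setD[sa nx]; apply/fmem_setD; split=> //; exact: st.
Qed.

(* Forced, below [q], that the relation [E] is a partial map from [K] onto a
   superset of [t]. *)
Definition covered A (K : set nat) (t : name P A) q :=
  exists E : nat -> A -> P -> Prop,
  [/\ forall k a r r', (r' <= r)%O -> E k a r -> E k a r',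
      forall k a r, E k a r -> K k,
      forall k a a' r, (r <= q)%O -> E k a r -> E k a' r -> a = a'
    & forall a r, (r <= q)%O -> fmem a t r ->
        dense_below [set r' | exists k, E k a r'] r].

Lemma coveredW A K (t t' : name P A) q q' :
  (q' <= q)%O -> fsub t' t q' -> covered K t q -> covered K t' q'.
Proof.
move=> qq tt [E [E1 E2 E3 E4]]; exists E; split=> //.
  by move=> k a a' r rq; apply: E3; exact: le_trans qq.
move=> a r rq ar; apply: E4; first exact: le_trans qq.
exact: tt.
Qed.

(* An element is sent to its least index in [E]. *)
Lemma covered_injection A K (t : name P A) q :
  covered K t q -> exists f, finjection t (check K) f q.
Proof.
case=> E [E1 E2 E3 E4].
(* Leastness is demanded at all conditions below [r], so [r] decides the least index and [M] passes
   to stronger conditions. *)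
pose M k a r := E k a r /\
  forall j, (j < k)%N -> forall r', (r' <= r)%O -> ~ E j a r'.
have MW k a r r' : (r' <= r)%O -> M k a r -> M k a r'.
  move=> rr [Ek mk]; split; first exact: E1 Ek.
  by move=> j jk s sr; apply: (mk j jk); exact: le_trans rr.
(* Strong induction on [k]: either some condition below [r] gives [a] a smaller index, or [k] is
   already least at [r]. *)
have minE k a r : E k a r -> exists2 r', (r' <= r)%O & exists j, M j a r'.
  elim/ltn_ind: k r => k IH r Ek.
  have [[j jk [s sr Ej]]|N] :=
    pselect (exists2 j, (j < k)%N & exists2 s, (s <= r)%O & E j a s).
    have [r' r's h] := IH j jk s Ej; exists r' => //; exact: le_trans sr.
  exists r => //; exists k; split=> // j jk s sr Ej; apply: N.
  by exists j => //; exists s.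
pose f : name P (A * nat) := [set x | fmem x.2.1 t x.1 /\ M x.2.2 x.2.1 x.1].
have fE a k r : fmem (a, k) f r ->
    forall r1, (r1 <= r)%O -> exists2 r2, (r2 <= r1)%O & M k a r2 /\ fmem a t r2.
  move=> h r1 /h[r2 r21 [s [/= fs Ms] r2s]]; exists r2 => //.
  by split; [exact: MW Ms | exact: fmemW fs].
have fI a k r : fmem a t r -> M k a r -> fmem (a, k) f r.
  by move=> ar Mr; apply: fmem_base (lexx r).
exists f; split.
  move=> a k r rq /fE h; split.
    by apply: fmem_dense => r1 /h[r2 ? [_ ?]]; exists r2.
  by have [r2 _ [[/E2 Kk _] _]] := h r (lexx r); apply/fmem_check.
split.
  move=> a r rq ar r1 r1r.
  have [r2 r21 [k Ek]] := E4 a r rq ar r1 r1r.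
  have [r3 r32 [j Mj]] := minE k a r2 Ek.
  exists r3; first exact: le_trans r21.
  exists j; apply: fI => //; apply: fmemW ar.
  by apply: le_trans r1r; exact: le_trans r21.
split.
  move=> a k k' r rq [/fE h /fE h'].
  have [r1 r1r [M1 _]] := h r (lexx r).
  have [r2 r21 [[E2' m2] _]] := h' r1 r1r.
  have [E1' m1] := MW _ _ _ _ r21 M1.
  rewrite /fground; case: (ltngtP k k') => // kk.
    by have := m2 _ kk r2 (lexx r2).
  by have := m1 _ kk r2 (lexx r2).
move=> a a' k r rq [/fE h /fE h'].
have [r1 r1r [M1 _]] := h r (lexx r).
have [r2 r21 [[Ea' _] _]] := h' r1 r1r.
have [Ea _] := MW _ _ _ _ r21 M1.
by apply: E3 Ea Ea'; apply: le_trans rq; exact: le_trans r1r.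
Qed.

(** The covering relation is the inverse of the injection. *)
Lemma injection_covered A K (t : name P A) f q :
  finjection t (check K) f q -> covered K t q.
Proof.
case=> f1 [f2 [f3 f4]].
exists (fun k a r => fmem (a, k) f r /\ K k); split.
- by move=> k a r r' rr [fk Kk]; split=> //; exact: fmemW fk.
- by move=> k a r [].
- by move=> k a a' r rq [fa _] [fa' _]; exact: (f4 a a' k r rq).
- move=> a r rq /(f2 a r rq); apply: sub_dense_below => s sr [k fk].
  exists k; split=> //.
  have [_ /fmem_check //] := f1 a k s (le_trans sr rq) fk.
Qed.

(** Replaces names for injections by ground-model relations, which can be shifted, glued and
    restricted directly. *)
Lemma fcard_leP A K (t : name P A) p :
  fcard_le t (check K) p <-> dense_below (covered K t) p.
Proof.
split; apply: sub_dense_below => q _; last exact: covered_injection.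
by case=> f; exact: injection_covered.
Qed.

Lemma fcountableP A (t : name P A) p :
  fcountable t p <-> dense_below (covered setT t) p.
Proof. exact: fcard_leP. Qed.

Lemma ffiniteP A (t : name P A) p :
  ffinite t p <-> dense_below [set q | exists n, covered `I_n t q] p.
Proof.
split=> h.
  apply: dense_below_dense; apply: sub_dense_below h => q _ [n /fcard_leP].
  by apply: sub_dense_below => r _ ?; exists n.
apply: sub_dense_below h => q _ [n c]; exists n; apply/fcard_leP.
by move=> r rq; exists r => //; exact: coveredW rq (@fsub_refl _ _ _) c.
Qed.

Lemma fcountable_dense A (t : name P A) p :
  dense_below (fcountable t) p -> fcountable t p.
Proof. exact: dense_below_dense. Qed.

Lemma fcountableW A (t t' : name P A) p q :
  (q <= p)%O -> fsub t' t q -> fcountable t p -> fcountable t' q.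
Proof.
move=> qp tt /fcountableP h; apply/fcountableP.
apply: sub_dense_below (dense_belowW qp h) => r rq.
by apply: coveredW => //; exact: fsubW tt.
Qed.

Lemma ffiniteW A (t t' : name P A) p q :
  (q <= p)%O -> fsub t' t q -> ffinite t p -> ffinite t' q.
Proof.
move=> qp tt /ffiniteP h; apply/ffiniteP.
apply: sub_dense_below (dense_belowW qp h) => r rq [n c]; exists n.
by apply: coveredW c => //; exact: fsubW tt.
Qed.

Lemma covered_union A (s s' t : name P A) m n q :
  (forall a r, (r <= q)%O -> fmem a t r ->
     dense_below [set r' | fmem a s r' \/ fmem a s' r'] r) ->
  covered `I_m s q -> covered `I_n s' q -> covered `I_(m + n) t q.
Proof.
move=> ss [E [E1 E2 E3 E4]] [F [F1 F2 F3 F4]].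
(* Indices below [m] serve [s]; those of [s'] are shifted by [m], so no index serves both. *)
exists (fun k a r => E k a r \/ (m <= k)%N /\ F (k - m) a r); split.
- move=> k a r r' rr [Ek|[mk Fk]]; first by left; exact: E1 Ek.
  by right; split=> //; exact: F1 Fk.
- move=> k a r [/E2|[mk /F2]] /=; first by move=> km; exact: ltn_addr.
  by rewrite ltn_subLR.
- move=> k a a' r rq [Ea|[mk Fa]] [Ea'|[mk' Fa']].
  + exact: E3 Ea Ea'.
  + by have := E2 _ _ _ Ea; rewrite /= ltnNge mk'.
  + by have := E2 _ _ _ Ea'; rewrite /= ltnNge mk.
  + exact: F3 Fa Fa'.
- move=> a r rq ar r1 r1r; have [r2 r21 ar2] := ss a r rq ar r1 r1r.
  have r2q : (r2 <= q)%O by apply: le_trans rq; exact: le_trans r1r.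
  case: ar2 => [/(E4 _ _ r2q)|/(F4 _ _ r2q)] /(_ r2 (lexx r2))[r3 r32 [k Ek]];
    (exists r3; first exact: le_trans r21).
    by exists k; left.
  by exists (m + k); right; rewrite leq_addr addKn.
Qed.

Lemma ffinite_union A (s s' t : name P A) p :
  (forall a r, (r <= p)%O -> fmem a t r ->
     dense_below [set r' | fmem a s r' \/ fmem a s' r'] r) ->
  ffinite s p -> ffinite s' p -> ffinite t p.
Proof.
move=> ss /ffiniteP fs /ffiniteP fs'; apply/ffiniteP => q qp.
have [r rq [m cm]] := fs q qp.
have [r' r'r [n cn]] := fs' r (le_trans rq qp).
have r'q := le_trans r'r rq; exists r' => //; exists (m + n).
apply: (@covered_union _ s s') => //.
  by move=> a v vr; apply: ss; apply: le_trans qp; exact: le_trans r'q.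
exact: coveredW r'r (@fsub_refl _ _ _) cm.
Qed.

(** Each element lies outside [x] or outside [y], so the two differences cover [s]. This is why a
    name for an infinite set cannot be almost contained in two disjoint sets. *)
Lemma ffinite_setD_disjoint A (s : name P A) (x y : set A) p :
  x `&` y = set0 -> ffinite (fsetD s x) p -> ffinite (fsetD s y) p ->
  ffinite s p.
Proof.
move=> xy; apply: ffinite_union => a r _ ar q qr; exists q => //.
have aq := fmemW qr ar.
have [xa|nxa] := pselect (x a); [right|left]; apply/fmem_setD; split=> //.
by move=> ya; suff: set0 a by []; rewrite -xy.
Qed.

(** * Antichains and the use of properness *)

Definition antichain (A : set P) :=
  forall a b r, A a -> A b -> (r <= a)%O -> (r <= b)%O -> a = b.

(** Two conditions are incompatible when the cones below them are disjoint, so a maximal disjoint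
    subfamily of cones gives an antichain that is maximal within [D]. *)
Lemma ex_maximal_antichain (D : set P) : exists2 A, A `<=` D &
  antichain A /\
  forall q, D q -> exists2 a, A a & exists2 r, (r <= q)%O & (r <= a)%O.
Proof.
have [A [AD tA mA]] := ex_maximal_disjoint_subcollection
  (fun q => [set r : P | (r <= q)%O]) D.
have antiA : antichain A.
  by move=> a b r Aa Ab ra rb; apply: (tA a b Aa Ab); exists r.
exists A => //; split=> // q Dq; apply: contrapT => N.
have nA a r : A a -> (r <= q)%O -> (r <= a)%O -> False.
  by move=> Aa rq ra; apply: N; exists a => //; exists r.
apply: (mA (q |` A)).
- split; first by move=> a; right.
  by move=> /(_ q (or_introl erefl)) Aq; exact: nA Aq (lexx q) (lexx q).
- by move=> a [->//|/AD].
- move=> a b [->|Aa] [->|Ab] [r [/= ra rb]] //.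
  + by case: (nA b r).
  + by case: (nA a r).
  + exact: antiA ra rb.
Qed.

(** One condition need not carry coverings of all [u n] at once. For each [n] they are glued along a
    maximal antichain of conditions carrying one, and index [k] for [u n] becomes the code of
    [(n, k)]. *)
Lemma fcountable_bigcup A (u : nat -> name P A) p :
  (forall n, fcountable (u n) p) -> fcountable (fbigcup u) p.
Proof.
move=> cu; apply/fcountableP => p' p'p; exists p' => //.
have /choice[B HB] : forall n, exists B : set P, B `<=` covered setT (u n) /\
    (antichain B /\ forall q, covered setT (u n) q ->
      exists2 a, B a & exists2 r, (r <= q)%O & (r <= a)%O).
  move=> n; have [B ? ?] := ex_maximal_antichain (covered setT (u n)).
  by exists B.
have /choice[E HE] : forall x : nat * P, exists E : nat -> A -> P -> Prop,
  B x.1 x.2 ->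
  [/\ forall k a r r', (r' <= r)%O -> E k a r -> E k a r',
      forall k a a' r, (r <= x.2)%O -> E k a r -> E k a' r -> a = a'
    & forall a r, (r <= x.2)%O -> fmem a (u x.1) r ->
        dense_below [set r' | exists k, E k a r'] r].
  move=> x; have [Bx|?] := pselect (B x.1 x.2); last by exists (fun _ _ _ => True).
  have [/(_ _ Bx)[E [E1 E2 E3 E4]] _] := HB x.1.
  by exists E.
exists (fun m a r => exists n k b, [/\ m = pickle (n, k), B n b, (r <= b)%O
  & E (n, b) k a r]); split=> //.
- move=> m a r r' rr [n [k [b [-> Bb rb Ek]]]]; exists n, k, b; split=> //.
    exact: le_trans rb.
  by have [E1 _ _] := HE (n, b) Bb; exact: E1 Ek.
- move=> m a a' r rp [n [k [b [-> Bb rb Ek]]]] [n' [k' [b' [+ Bb' rb' Ek']]]].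
  move/(pcan_inj pickleK) => [nn kk]; subst n' k'.
  have [_ [/(_ _ _ _ Bb Bb' rb rb') bb _]] := HB n; subst b'.
  by have [_ E3 _] := HE (n, b) Bb; exact: E3 Ek Ek'.
- move=> a r rp /fmem_bigcup ar r1 r1r.
  have [r2 r21 [n ar2]] := ar r1 r1r.
  have r2p : (r2 <= p)%O.
    by apply: le_trans p'p; apply: le_trans rp; exact: le_trans r1r.
  have /fcountableP /(_ r2 r2p)[r3 r32 c3] := cu n.
  have [_ [_ /(_ r3 c3)[b Bb [r4 r43 r4b]]]] := HB n.
  have [E1 _ E4] := HE (n, b) Bb.
  have r42 := le_trans r43 r32.
  have [r5 r54 [k Ek]] := E4 a r4 r4b (fmemW r42 ar2) r4 (lexx r4).
  exists r5; first by apply: le_trans r21; exact: le_trans r42.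
  exists (pickle (n, k)), n, k, b; split=> //; exact: le_trans r4b.
Qed.

(* Properness is used only through the club of all countable sets containing
   the trace of the generic filter on the given antichains. *)
Lemma proper_covering : proper_poset P -> ~ countable [set: P] ->
  forall (B : nat -> set P), (forall n, antichain (B n)) ->
  forall p, exists2 q, (q <= p)%O & exists2 s : set (P * nat), countable s &
    forall n b r, B n b -> (r <= q)%O -> (r <= b)%O -> s (b, n).
Proof.
move=> properP uncP B antiB p.
pose A := (P * nat)%type.
have uncA : ~ countable [set: A].
  move=> /countable_injP[f finj]; apply: uncP; apply/countable_injP.
  exists (fun q => f (q, 0)) => x y _ _ /finj.
  by rewrite !inE => /(_ I I) [].
(* A name for the set of pairs [(b, n)] with [b] in both [B n] and the generic filter. *)
pose sg : name P A := [set x | x.1 = x.2.1 /\ B x.2.2 x.2.1].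
have sgE b n r : fmem (b, n) sg r ->
    forall r1, (r1 <= r)%O -> exists2 r2, (r2 <= r1)%O & B n b /\ (r2 <= b)%O.
  by move=> h r1 /h[r2 r21 [x [/= -> Bx] xb]]; exists r2.
(* The generic filter contains at most one element of each antichain, so [n] can serve as the index
   of [(b, n)]. *)
have csg q : fcountable sg q.
  apply/fcountableP => r _; exists r => //.
  exists (fun k x r => k = x.2 /\ fmem x sg r); split=> //.
  - by move=> k a v v' vv [-> ?]; split=> //; exact: fmemW vv _.
  - move=> k [b n] [b' n'] v _ [/= -> /sgE h] [/= <- /sgE h'].
    have [v1 v1v [Bb vb]] := h v (lexx v).
    have [v2 v21 [Bb' vb']] := h' v1 v1v.
    by congr pair; apply: antiB Bb Bb' _ vb'; exact: le_trans vb.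
  - move=> a v _ av w wv; exists w => //; exists a.2; split=> //; exact: fmemW av.
pose C : name P (name P A) := [set x | fcountable x.2 x.1 /\ fsub sg x.2 x.1].
have CI t q : fcountable t q -> fsub sg t q -> fmem2 t C q.
  move=> ct st r rq; exists r => //; exists r, t; split=> //.
    split=> /=; last exact: fsubW st.
    exact: fcountableW rq (@fsub_refl _ _ _) ct.
  by split; exact: fsub_refl.
have CE t q : fmem2 t C q -> fcountable t q /\ fsub sg t q.
  move=> h; split; [apply: fcountable_dense|apply: fsub_dense];
    apply: sub_dense_below h => r _ [v [w [[/= cw sw] rv [tw wt]]]].
    exact: fcountableW cw.
  exact: fsub_trans (fsubW rv sw) wt.
have clubC q : fclub C q.
  split; first by move=> t r _ /CE[].
  split.
    move=> t r _ ct v vr.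
    (* The union of [t] and [sg] is written as a countable union, so that [fcountable_bigcup]
       applies. *)
    pose u n := if n is 0 then t else sg.
    exists v => //; exists (fbigcup u).
    have sub n : fsub (u n) (fbigcup u) v.
      move=> a w wv aw; apply/fmem_bigcup => w' ww; exists w' => //.
      by exists n; exact: fmemW aw.
    split; last exact: (sub 0).
    apply: CI; last exact: (sub 1).
    apply: fcountable_bigcup => -[|n] //=.
    exact: fcountableW vr (@fsub_refl _ _ _) ct.
  move=> u r _ [uC _]; apply: CI.
    by apply: fcountable_bigcup => n; have [] := CE _ _ (uC n).
  move=> a v vr av; apply/fmem_bigcup => w wv; exists w => //; exists 0.
  have [_ /(_ a v vr av) su0] := CE _ _ (uC 0); exact: fmemW su0.
(* By properness the family of countable ground-model sets stays stationary, so it meets [C]: some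
   condition below [p] forces a countable ground-model set to contain [sg]. *)
have stS : stationary [set s : set A | countable s].
  split=> // D [Dc Ds _]; have [t Dt _] := Ds set0 (countable0 _).
  by exists t => //; exact: Dc.
have [_ /(_ C p (lexx p) (clubC p) p (lexx p))] := properP A uncA _ stS p.
case=> q qp [t [/CE[_ sgt] /(_ q (lexx q))[r rq [v [w [[s cs /= ws] _ [tw _]]]]]]].
subst w; exists r; first exact: le_trans qp.
exists s => // n b r' Bb r'r r'b.
have sgr : fmem (b, n) sg r' by apply: (fmem_base (r := b)).
have := sgt (b, n) r' (le_trans r'r rq) sgr.
by move/(tw _ _ r'r)/fmem_check.
Qed.

End ForcingFacts.

(** * Towers *)

Lemma almost_sub_trans y x z :
  almost_sub x y -> almost_sub y z -> almost_sub x z.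
Proof.
move=> xy yz; apply: sub_finite_set (_ : finite_set ((x `\` y) `|` (y `\` z))).
  by move=> a [xa nza]; have [ya|nya] := pselect (y a); [right|left].
by rewrite finite_setU.
Qed.

Lemma sub_almost_sub x y : x `<=` y -> almost_sub x y.
Proof. by rewrite /almost_sub -setD_eq0 => ->. Qed.

(** The halves are the terms of even and of odd index in an injective sequence in [z]. *)
Lemma infinite_halves (z : set nat) : infinite_set z ->
  exists z0 z1, [/\ infinite_set z0, infinite_set z1, z0 `&` z1 = set0,
    z0 `<=` z & z1 `<=` z].
Proof.
move=> /infiniteP/pcard_leP[f].
have fI : injective f by move=> x y; apply: 'inj_f; rewrite inE.
have fz n : z (f n) by apply: funS.
have inf (g : nat -> nat) : injective g -> infinite_set (range (f \o g)).
  move=> gI; apply/infiniteP; rewrite (card_le_eqr (inj_card_eq _)) ?card_lexx //.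
  by move=> m n _ _ /fI/gI.
exists (range (f \o double)), (range (f \o (S \o double))); split.
- apply: inf; exact: double_inj.
- by apply: inf => x y [/double_inj].
- rewrite -subset0 => _ [[m _ <-] [n _ /fI /= e]].
  by have := congr1 odd e; rewrite /= !odd_double.
- by move=> _ [n _ <-]; exact: fz.
- by move=> _ [n _ <-]; exact: fz.
Qed.

(** A nonempty finite subfamily has a member [m] almost contained in all the others; removing
    finitely many finite differences from [m] leaves an infinite subset of the intersection. *)
Lemma almost_chain_fip (F : set (set nat)) :
  (forall x, F x -> infinite_set x) ->
  (forall x y, F x -> F y -> almost_sub x y \/ almost_sub y x) -> fip F.
Proof.
move=> infF chF G GF /finite_seqP[s Gs]; subst G.
have {GF} sF x : x \in s -> F x by move=> xs; exact: GF.
have [->|[m [ms ml]]] : s = [::] \/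
    exists m, m \in s /\ forall x, x \in s -> almost_sub m x.
  elim: s sF => [|x s IH] sF; [by left|right].
  have [y ys|->|[m [ms ml]]] := IH; first by apply: sF; rewrite inE ys orbT.
    exists x; split; rewrite ?mem_head // => y; rewrite inE => /eqP ->.
    exact: sub_almost_sub.
  have Fx : F x by apply: sF; rewrite mem_head.
  have Fm : F m by apply: sF; rewrite inE ms orbT.
  have [xm|mx] := chF x m Fx Fm.
    exists x; rewrite mem_head; split=> // y; rewrite inE => /orP[/eqP->|/ml].
      exact: sub_almost_sub.
    exact: almost_sub_trans.
  exists m; rewrite inE ms orbT; split=> // y; rewrite inE => /orP[/eqP->//|].
  exact: ml.
- by rewrite set_nil bigcap_set0; exact: infinite_nat.
- apply: sub_infinite_set (infinite_setD (infF m (sF m ms)) (_ :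
      finite_set (\bigcup_(x in [set` s]) (m `\` x)))); last first.
    by apply: bigcup_finite => // x; exact: ml.
  move=> a [ma na] x xs; apply: contrapT => nxa; by apply: na; exists x.
Qed.

(** * Well orders and recursion along them *)

Section WellOrder.
Context (T : eqType) (R : rel T) (woR : wochoice.well_order R).

Lemma wo_min (A : set T) : A !=set0 -> exists2 z, A z & forall x, A x -> R z x.
Proof.
case=> a Aa; have [|z [[zA zl] _]] := woR (A := mem A).
  by exists a; rewrite inE.
by exists z; [exact: set_mem|move=> x Ax; apply: zl; rewrite inE].
Qed.

(** [wochoice.well_order] speaks only of unique minima; here [x] and [y] are both minima of the set
    consisting of the two. *)
Lemma wo_anti x y : R x y -> R y x -> x = y.
Proof.
move=> xy yx; have [|z [_ uz]] := woR (A := [pred w | (w == x) || (w == y)]).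
  by exists x; rewrite inE eqxx.
have Rxx w : R w w.
  by have [z' /= -> /(_ w erefl)] := wo_min (A := [set w]) (ex_intro _ w erefl).
rewrite -(uz x) ?(uz y) //; split; rewrite ?inE ?eqxx ?orbT // => w.
  by rewrite inE => /orP[]/eqP->.
by rewrite inE => /orP[]/eqP->.
Qed.

Lemma wo_total x y : R x y \/ R y x.
Proof.
have [|z [->|->] h] := wo_min (A := [set x; y]); first by exists x; left.
  by left; apply: h; right.
by right; apply: h; left.
Qed.

Lemma wo_trans x y z : R x y -> R y z -> R x z.
Proof.
move=> xy yz; have [|w [[]|] -> h] := wo_min (A := [set x; y; z]).
- by exists x; left; left.
- by apply: h; right.
- by have -> := wo_anti xy (h _ (or_introl (or_introl erefl))).
- by rewrite -(wo_anti yz (h _ (or_introl (or_intror erefl)))).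
Qed.

Definition wo_lt x y := R x y /\ x <> y.

Lemma wo_lt_wf : well_founded wo_lt.
Proof.
move=> a; apply: contrapT => nA.
have [z nz zl] := wo_min (A := [set x | ~ Acc wo_lt x]) (ex_intro _ a nA).
apply: nz; constructor => y [yz ne]; apply: contrapT => /zl zy.
by apply: ne; exact: wo_anti.
Qed.

Lemma wo_lt_total x y : [\/ wo_lt x y, x = y | wo_lt y x].
Proof.
have [->|ne] := pselect (x = y); first by constructor 2.
by have [h|h] := wo_total x y; [constructor 1|constructor 3]; split=> // /esym.
Qed.

Lemma wo_lt_trans x y z : wo_lt x y -> wo_lt y z -> wo_lt x z.
Proof.
move=> [xy ne] [yz _]; split; first exact: wo_trans yz.
by move=> xz; apply: ne; apply: wo_anti => //; rewrite xz.
Qed.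

End WellOrder.

(** The step sees the earlier values only as a set, so pointwise equal recursive calls give the same
    result, as [Fix_eq] requires. *)
Lemma wf_recursion T U (lt : T -> T -> Prop) (step : T -> set U -> U) :
  well_founded lt -> exists f, forall a, f a = step a (f @` [set b | lt b a]).
Proof.
move=> wf.
pose F a (rec : forall b, lt b a -> U) := step a [set y | exists b h, rec b h = y].
exists (Fix wf (fun=> U) F) => a; rewrite Fix_eq.
  congr step; apply/seteqP; split=> y /=; first by move=> [b [h <-]]; exists b.
  by move=> [b h <-]; exists b, h.
move=> b f g fg; congr step; apply/seteqP.
by split=> y /= [c [h <-]]; exists c, h.
Qed.

(** * Construction of the tower *)

Definition splittable (B : set (set nat)) :=
  forall z0 z1, z0 `&` z1 = set0 -> B z0 -> B z1 -> False.

(** Avoiding [B] is conditional so that the recursion can proceed whatever [B] is. The failure of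
    [almost_sub x y] makes the tower strictly decreasing. *)
Definition good_extension (F B : set (set nat)) (y : set nat) :=
  [/\ infinite_set y, forall x, F x -> almost_sub y x /\ ~ almost_sub x y
    & splittable B -> ~ B y].

Lemma ex_good_extension F B : has_pseudointersection F ->
  exists y, good_extension F B y.
Proof.
move=> [z [infz zF]].
have [z0 [z1 [inf0 inf1 z01 z0z z1z]]] := infinite_halves infz.
(* The other half [y'] is almost contained in [x] and disjoint from [y], so [x] is not almost
   contained in [y]. *)
have half y y' : infinite_set y' -> y `&` y' = set0 -> y `<=` z -> y' `<=` z ->
    forall x, F x -> almost_sub y x /\ ~ almost_sub x y.
  move=> infy' yy' yz y'z x /zF zx; split.
    exact: almost_sub_trans (sub_almost_sub yz) zx.
  move=> xy; apply: infy'.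
  have := almost_sub_trans (sub_almost_sub y'z) (almost_sub_trans zx xy).
  apply: sub_finite_set => a y'a; split=> // ya.
  by suff: set0 a by []; rewrite -yy'.
have [B0|nB0] := pselect (B z0).
  exists z1; split=> //; last by move=> sB B1; exact: sB z01 B0 B1.
  by apply: half inf0 _ z1z z0z; rewrite setIC.
exists z0; split=> //; exact: half inf1 z01 z0z z1z.
Qed.

Lemma tower_meeting (p_eq_c : has_cardinality_p continuum)
    (T : Type) (c : T -> set nat) (B : T -> set (set nat)) : injective c ->
  exists X, tower X /\
    forall t, splittable (B t) -> exists2 x, X x & ~ B t x.
Proof.
move=> cI; have [R woR] := wochoice.well_ordering_principle (set nat).
pose lt := wo_lt R; pose seg a := [set b | lt b a].
(* The points with fewer than continuum many predecessors: an initial segment playing the role of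
   the ordinal c. *)
pose W := [set a | ~ (continuum #<= seg a)].
have Wlt a b : lt b a -> W a -> W b.
  move=> ba Wa cb; apply: Wa; apply: card_le_trans cb (subset_card_le _).
  by move=> e eb; exact: wo_lt_trans eb ba.
(* Either [W] is everything, or the least point outside it has continuum many predecessors, all in
   [W]. *)
have cW : continuum #<= W.
  have [WT|/existsNP[a0 na0]] := pselect (forall a, W a).
    by apply: subset_card_le => a _; exact: WT.
  have [a /= na al] := wo_min woR (A := [set a | ~ W a]) (ex_intro _ a0 na0).
  move/contrapT: na => ca; apply: card_le_trans ca (subset_card_le _).
  move=> b [ba ne]; apply: contrapT => /al ab; apply: ne; exact: wo_anti ab.
have [h] := pcard_leP cW.
have hI : injective h by move=> x y; apply: 'inj_h; rewrite inE.
have hW x : W (h x) by apply: (@funS _ _ continuum W h).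
(* Each requirement [t] gets its own stage [h (c t)]; at all other stages there is nothing to
   avoid. *)
pose bad a : set (set nat) := [set y | exists2 t, h (c t) = a & B t y].
(* [setT] is a default value; [xP] shows that good extensions exist at all stages in [W]. *)
have [x xE] := wf_recursion
  (fun a F => xget setT (good_extension F (bad a))) (wo_lt_wf woR).
have xP a : W a -> good_extension (x @` seg a) (bad a) (x a).
  elim/(well_founded_ind (wo_lt_wf woR)): a => a IH Wa.
  (* Without a pseudointersection the family built so far would have size at least p = c, but it is
     indexed by the predecessors of [a]. *)
  rewrite xE; apply: xgetPex; apply: ex_good_extension; apply: contrapT => nF.
  apply: (Wa).
  have seg_inf y : (x @` seg a) y -> infinite_set y.
    by move=> [b ba <-]; have [] := IH b ba (Wlt _ _ ba Wa).
  suff /p_eq_c.2 h1 : p_witness (x @` seg a)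
    by apply: card_le_trans h1 (card_image_le _ _).
  split=> //; apply: almost_chain_fip => // _ _ [b ba <-] [e ea <-].
  have [be|->|eb] := wo_lt_total woR b e.
  - right; have [_ /(_ (x b)) []] := IH e ea (Wlt _ _ ea Wa); by [exists b|].
  - by left; exact: sub_almost_sub.
  - left; have [_ /(_ (x e)) []] := IH b ba (Wlt _ _ ba Wa); by [exists e|].
have xlt a b : W a -> lt b a -> almost_sub (x a) (x b) /\ ~ almost_sub (x b) (x a).
  by move=> Wa ba; have [_ + _] := xP a Wa; apply; exists b.
exists (x @` W); split; first split.
- by move=> _ [a /xP[] ? _ _ <-].
- apply: wochoice.antisymmetric_wo_chain.
    move=> _ _ /set_mem[a Wa <-] /set_mem[b Wb <-] /andP[/asboolP ba /asboolP ab].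
    have [l|->//|l] := wo_lt_total woR a b.
      by have [_ []] := xlt b a Wb l.
    by have [_ []] := xlt a b Wa l.
  move=> A AX [y Ay]; have /set_mem[a0 Wa0 xa0] := AX y Ay.
  (* Later values are almost contained in earlier ones, so the minimum of [A] is its value of least
     index. *)
  have [|a [Wa Aa] al] := wo_min woR (A := [set a | W a /\ x a \in A]).
    by exists a0; rewrite /= xa0.
  exists (x a); split=> // z Az; have /set_mem[b Wb xb] := AX z Az.
  subst z; apply/asboolP.
  have [l|->|l] := wo_lt_total woR a b.
  + by have [] := xlt b a Wb l.
  + exact: sub_almost_sub.
  + have ab := al b (conj Wb Az); case: l => ba ne.
    by case: ne; exact: (wo_anti woR).
- move=> t sB; exists (x (h (c t))); first by exists (h (c t)).
  have [_ _ nb] := xP _ (hW (c t)) => Bt.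
  have badE : bad (h (c t)) = B t.
    by apply/seteqP; split=> y /=; [move=> [t' /hI/cI->]|exists t].
  by rewrite badE in nb; exact: nb Bt.
Qed.

(** * Countable names *)

Definition countable_name d (P : porderType d) A (e : nat -> P)
    (B : nat -> set A) : name P A := [set x | exists2 k, e k = x.1 & B k x.2].

(** For each [n], take a maximal antichain of conditions forcing [n] into [y]. Below [q] the generic
    filter meets these antichains only within a countable set, whose conditions suffice for the new
    name. *)
Lemma proper_countable_name d (P : porderType d) : proper_poset P ->
  ~ countable [set: P] -> forall (y : name P nat) p,
  exists2 q, (q <= p)%O & exists e B, feq y (countable_name e B) q.
Proof.
move=> properP uncP y p.
have /choice[A HA] : forall n, exists A : set P, A `<=` fmem n y /\
    (antichain A /\ forall q, fmem n y q ->
      exists2 a, A a & exists2 r, (r <= q)%O & (r <= a)%O).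
  by move=> n; have [A ? ?] := ex_maximal_antichain (fmem n y); exists A.
have [|q qp [s /countable_injP[f fI] sP]] :=
  @proper_covering _ P properP uncP A _ p; first by move=> n; have [_ []] := HA n.
(* [e] inverts the injection [f] on [s] and keeps the condition; [p] is the default outside the
   range of [f]. *)
have /choice[e eP] : forall k, exists a : P,
    forall x, s x -> f x = k -> a = x.1.
  move=> k; have [[x sx fx]|N] := pselect (exists2 x, s x & f x = k).
    exists x.1 => x' sx' fx'; congr fst; apply: fI; rewrite ?inE //.
    by rewrite fx fx'.
  by exists p => x sx fx; case: N; exists x.
exists q => //; exists e, (fun k n => A n (e k)); split=> n r rq.
  move=> yn r1 r1r; have [_ [_ /(_ r1 (fmemW r1r yn))[a Aa [r2 r21 r2a]]]] := HA n.
  have r2q : (r2 <= q)%O by apply: le_trans rq; exact: le_trans r1r.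
  exists r2 => //; exists a => //; have san := sP n a r2 Aa r2q r2a.
  by have ea := eP _ _ san erefl; exists (f (a, n)); rewrite /= ea.
move=> h; apply: fmem_dense; apply: sub_dense_below h => r' _ [a [k /= <- Aa] r'a].
by have [/(_ _ Aa) + _] := HA n; exact: fmemW.
Qed.

(** * Coding of the requirements by sets of natural numbers *)

Definition join_sets (h : nat -> set nat) : set nat :=
  [set m | exists j k, m = pickle (j, k) /\ h j k].

Lemma join_sets_inj : injective join_sets.
Proof.
have sub g h : join_sets g `<=` join_sets h -> forall j, g j `<=` h j.
  move=> gh j k gk; have [|j' [k' [+ hk]]] := gh (pickle (j, k)).
    by exists j, k.
  by move/(pcan_inj pickleK) => [-> ->].
move=> g h gh; apply/funext => j; apply/seteqP.
by split; apply: sub; rewrite gh.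
Qed.

Lemma set_nat_uncountable : ~ countable [set: set nat].
Proof.
move=> /countable_injP[f fI].
pose D := [set n | exists2 A, f A = n & ~ A n].
have [Df|nDf] := pselect (D (f D)).
  have [A fA nA] := Df; apply: nA.
  by have -> : A = D by apply: fI; rewrite ?inE.
by apply: (nDf); exists D.
Qed.

Theorem theorem4p1 (p_eq_c : has_cardinality_p continuum)
    (I : Type) (I_le_c : [set: I] #<= continuum)
    (d : Order.disp_t) (P : I -> porderType d)
    (P_card : forall i : I, [set: P i] #= continuum)
    (P_proper : forall i : I, proper_poset (P i)) :
  exists X : set (set nat),
    maximal_tower X /\ forall i : I, indestructible (P i) X.
Proof.
have [psi psiI] := pcard_injP I_le_c.
have phiP i : {f : P i -> set nat | injective f}.
  apply: cid; have [/pcard_injP[f fI] _] := (card_eqPle _ _).1 (P_card i).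
  by exists f => x y; apply: fI; rewrite inE.
pose phi i := sval (phiP i).
have phiI i : injective (phi i) by exact: svalP (phiP i).
have uncP i : ~ countable [set: P i].
  move=> cP; apply: set_nat_uncountable; apply: card_le_trans cP.
  by have [] := (card_eqPle _ _).1 (P_card i).
pose data := {i : I & (P i * (nat -> P i) * (nat -> set nat))%type}.
(* Row 0 tags the summand. For a name, rows 1 to 3 hold the index, the condition and [B]; the later
   rows list [e]. *)
pose code (t : data + set nat) : set nat := join_sets (fun j =>
  match t, j with
  | inl _, 0 => set0
  | inl (existT i _), 1 => psi i
  | inl (existT i (q, _, _)), 2 => phi i q
  | inl (existT i (_, _, B)), 3 => join_sets B
  | inl (existT i (_, e, _)), j.+4 => phi i (e j)
  | inr _, 0 => setT
  | inr y, _ => y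
  end).
have codeI : injective code.
  have s0T : @set0 nat <> setT by move=> h; suff: set0 0 by []; rewrite h.
  move=> t t' /join_sets_inj codeE; have tt' j := congr1 (fun h => h j) codeE.
  case: t t' tt' {codeE} => [[i [[q e] B]]|y] [[i' [[q' e'] B']]|y'] tt'.
  - have ii : i = i' by apply: psiI (tt' 1); rewrite inE.
    subst i'.
    have /phiI <- := tt' 2; have /join_sets_inj <- := tt' 3.
    by have -> : e = e' by apply/funext => k; have /phiI := tt' k.+4.
  - by case: s0T; exact: (tt' 0).
  - by case: s0T; exact/esym/(tt' 0).
  - by congr inr; exact: (tt' 1).
(* The left summand serves indestructibility, the right one maximality in the ground model. *)
pose bad (t : data + set nat) : set (set nat) :=
  match t with
  | inl (existT i (q, e, B)) =>
      [set x | ffinite (fsetD (countable_name e B) x) q]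
  | inr y => [set x | almost_sub y x]
  end.
have [X [towerX meetX]] := tower_meeting p_eq_c bad codeI.
exists X; split; first split=> // -[y [infy yX]].
  have [|x Xx] := meetX (inr y); last by apply; exact: yX.
  move=> z0 z1 z01 yz0 yz1; apply: infy.
  apply: sub_finite_set (_ : finite_set ((y `\` z0) `|` (y `\` z1))).
    move=> a ya; have [z0a|] := pselect (z0 a); [right|by left].
    by split=> // z1a; suff: set0 a by []; rewrite -z01.
  by rewrite finite_setU.
move=> i p p' p'p /(_ p' (lexx p'))[r rp' [y [infy yX]]].
have [q qr [e [B [yy' y'y]]]] := proper_countable_name (P_proper i) (uncP i) y r.
(* The requirement is splittable because [q] does not force [y] to be finite. The [x] obtained
   contradicts that [r] forces [y] to be almost contained in [x]. *)
have [|x Xx] := meetX (inl (existT _ i (q, e, B))).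
  move=> z0 z1 z01 f0 f1; apply: (infy q qr).
  exact: ffiniteW (lexx q) yy' (ffinite_setD_disjoint z01 f0 f1).
by apply; exact: ffiniteW qr (fsub_setD (x := x) y'y) (yX x r (lexx r) Xx).
Qed.
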